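(* Let $\mathcal{X}$ be a real Banach space with $\dim\mathcal{X}\ge2$, let $p>1$, $\mathcal{F}=\frac1p\|\cdot\|^p$, let $j_p$ be a selection of the duality mapping $J_p$ of $\mathcal{X}$, and let $\phi:[0,\infty)\to[0,\infty)$ be nondecreasing with $\phi(\tau)>0$ for $\tau>0$. Let $V=(\mathcal{X}\setminus\{0\})\times\mathcal{X}$ and consider the statements: (d) There exist $C,c>0$ such that for all $(x,y)\in V$ with $\|x-y\|\le c\|x\|$: $\ \Delta_{\mathcal{F}}^{j_p(x)}(y,x)\ge C\|x\|^p\,\phi\!\left(\frac{\|x-y\|}{\|x\|}\right)$. (e) There exists $C>0$ such that for all $(x,y)\in V$: $\ \Delta_{\mathcal{F}}^{j_p(x)}(y,x)\ge C\max\{\|x\|,\|y\|\}^p\,\phi\!\left(\frac{\|x-y\|}{\max\{\|x\|,\|y\|\}}\right)$. (f) There exists $C>0$ such that for all $(x,y)\in V$: $\ \Delta_{\mathcal{F}}^{\mathrm{sym}}(x,y)\ge C\max\{\|x\|,\|y\|\}^p\,\phi\!\left(\frac{\|x-y\|}{\max\{\|x\|,\|y\|\}}\right)$. Then (d) implies (e), and (e) implies (f).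
   Context: Duality mapping: $J_p(x)=\{x^*\in\mathcal{X}^*:\langle x^*,x\rangle=\|x^*\|\|x\|,\ \|x^*\|=\|x\|^{p-1}\}$; a selection $j_p:\mathcal{X}\to\mathcal{X}^*$ satisfies $j_p(x)\in J_p(x)$ for all $x$. Bregman divergence: $\Delta_{\mathcal{F}}^{\xi}(y,x)=\mathcal{F}(y)-\mathcal{F}(x)-\langle\xi,y-x\rangle$. Symmetric Bregman divergence: $\Delta_{\mathcal{F}}^{\mathrm{sym}}(x,y)=\Delta_{\mathcal{F}}^{j_p(x)}(y,x)+\Delta_{\mathcal{F}}^{j_p(y)}(x,y)=\langle j_p(x)-j_p(y),x-y\rangle$. *)

(* Defs.v *)
From mathcomp Require Import all_boot all_order all_algebra.
From mathcomp Require Import all_classical all_reals all_analysis.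

Set Implicit Arguments.
Unset Strict Implicit.
Unset Printing Implicit Defensive.

Import Order.TTheory GRing.Theory Num.Theory.
Import numFieldNormedType.Exports.

Local Open Scope classical_set_scope.
Local Open Scope ring_scope.

(* dim X >= n, for X possibly infinite-dimensional *)
Definition dim_ge (R : realType) (X : lmodType R) (n : nat) : Prop :=
  exists v : 'I_n -> X,
    forall a : 'I_n -> R, \sum_(i < n) a i *: v i = 0 -> forall i, a i = 0.

Record dual (R : realType) (X : normedModType R) := Dual {
  dual_fun :> {linear X -> R^o} ;
  dual_continuous : continuous dual_fun }.

Section Duality.
Context (R : realType) (X : normedModType R).
Implicit Types (f xi : dual X) (x y : X) (p : R).

Definition pairing f x : R := f x.

(* The set is nonempty, and bounded since f is continuous, so that the real
   sup is the operator norm. *)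
Definition dual_norm f : R :=
  sup [set `|pairing f x| | x in [set x : X | `|x| <= 1]].

Definition duality_mapping p x : set (dual X) :=
  [set f | pairing f x = dual_norm f * `|x| /\ dual_norm f = `|x| `^ (p - 1)].

Definition duality_selection p (j : X -> dual X) : Prop :=
  forall x, duality_mapping p x (j x).

Definition norm_pow_functional p x : R := p^-1 * `|x| `^ p.

Definition bregman (F : X -> R) xi y x : R := F y - F x - pairing xi (y - x).

Definition sym_bregman (F : X -> R) (j : X -> dual X) x y : R :=
  bregman F (j x) y x + bregman F (j y) x y.

Definition V_domain : set (X * X) := [set z | z.1 != 0].

Definition bregman_lower_local p (j : X -> dual X) (phi : R -> R) : Prop :=
  exists C c : R, [/\ 0 < C, 0 < c &
    forall x y, V_domain (x, y) -> `|x - y| <= c * `|x| ->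
      bregman (norm_pow_functional p) (j x) y x
        >= C * `|x| `^ p * phi (`|x - y| / `|x|)].

Definition bregman_lower_global p (j : X -> dual X) (phi : R -> R) : Prop :=
  exists C : R, 0 < C /\
    forall x y, V_domain (x, y) ->
      bregman (norm_pow_functional p) (j x) y x
        >= C * (Num.max `|x| `|y|) `^ p
             * phi (`|x - y| / Num.max `|x| `|y|).

Definition sym_bregman_lower_global p (j : X -> dual X) (phi : R -> R) : Prop :=
  exists C : R, 0 < C /\
    forall x y, V_domain (x, y) ->
      sym_bregman (norm_pow_functional p) j x y
        >= C * (Num.max `|x| `|y|) `^ p
             * phi (`|x - y| / Num.max `|x| `|y|).

End Duality.

(* Main.v *)
(** The subgradient inequality makes every Bregman divergence nonnegative, so
    (f) follows from (e) by dropping one summand.  For (d) => (e), split on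
    whether [|y|] is bounded by a suitable multiple [L |x|].  If it is not,
    [|y|^p / p] dominates the pairing and the divergence is at least
    [|y|^p / (2 p)].  If it is, (d) applies directly when [|x - y| <= c |x|];
    otherwise it applies to the point of the segment [x, y] at distance
    [c |x|] from [x], and convexity of the divergence in its first argument
    transfers the bound to [y].  Outside the local regime [phi] may be
    replaced by the constant [phi 2], since its argument in (e) never
    exceeds [2]. *)
Require Import Defs.
From mathcomp Require Import all_boot all_order all_algebra.
From mathcomp Require Import all_classical all_reals all_analysis.
From mathcomp Require Import ring lra.

Set Implicit Arguments.
Unset Strict Implicit.
Unset Printing Implicit Defensive.

Import Order.TTheory GRing.Theory Num.Theory.
Import numFieldNormedType.Exports.

Local Open Scope classical_set_scope.
Local Open Scope ring_scope.

(** Continuity of [f] bounds the set under the real [sup], which is then a true upper bound; it is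
    tested at [x] scaled to norm 1. *)
Lemma pairing_le_dual_norm (R : realType) (X : normedModType R) (f : dual X)
  (x : X) : pairing f x <= dual_norm f * `|x|.
Proof.
have [->|x0] := eqVneq x 0.
  by rewrite /pairing linear0 normr0 mulr0.
have nx : 0 < `|x| by rewrite normr_gt0.
have /linear_boundedP/pinfty_ex_gt0 [M M0 fM] : bounded_near f (nbhs (0 : X)).
  exact/continuous_linear_bounded/dual_continuous.
have ub : has_ubound [set `|pairing f x| | x in [set x : X | `|x| <= 1]].
  exists M => _ [z /= z1 <-].
  by rewrite (le_trans (fM z))// ler_piMr// ltW.
rewrite -ler_pdivrMr//; apply: le_trans (ler_norm _) _.
apply: (ub_le_sup ub); exists (`|x|^-1 *: x) => /=.
  by rewrite normrZ ger0_norm ?invr_ge0// mulVf// gt_eqF.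
by rewrite /pairing linearZ /= mulrC.
Qed.

Section Bregman.
Context (R : realType) (X : normedModType R).
Variables (p : R) (hp : 1 < p) (j : X -> dual X).
Hypothesis hj : duality_selection p j.

Let p_gt0 : 0 < p. Proof. exact: lt_trans hp. Qed.

Local Notation F := (@norm_pow_functional R X p).
Local Notation D y x := (bregman F (j x) y x).

(** The two duality conditions give [pairing (j x) x] the value [|x|^p], which absorbs [- F x]. *)
Lemma bregman_norm_powE x y :
  D y x = p^-1 * `|y| `^ p + (1 - p^-1) * `|x| `^ p - pairing (j x) y.
Proof.
have [jx nj] := hj x.
have {}jx : pairing (j x) x = `|x| `^ p.
  by rewrite jx nj mulrC mulr_powRB1.
rewrite /bregman /norm_pow_functional.
have -> : pairing (j x) (y - x) = pairing (j x) y - pairing (j x) x.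
  by rewrite /pairing linearB.
by rewrite jx; ring.
Qed.

Lemma pairing_selection_le x y :
  pairing (j x) y <= `|x| `^ (p - 1) * `|y|.
Proof. by have [_ <-] := hj x; exact: pairing_le_dual_norm. Qed.

(** Young's inequality for [|y|] and [|x|^(p-1)], with conjugate exponents [p] and [p/(p-1)]. *)
Lemma bregman_ge0 x y : 0 <= D y x.
Proof.
rewrite bregman_norm_powE subr_ge0; apply: le_trans (pairing_selection_le x y) _.
have p1 : p - 1 != 0 by rewrite subr_eq0 gt_eqF.
have pn0 : p != 0 by rewrite gt_eqF.
have q0 : 0 < p / (p - 1) by rewrite divr_gt0// subr_gt0.
have pq : p^-1 + (p / (p - 1))^-1 = 1 by field; rewrite p1 pn0.
have := conjugate_powR (normr_ge0 y) (powR_ge0 `|x| (p - 1)) p_gt0 q0 pq.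
rewrite -powRrM [(p - 1) * _]mulrC divfK// mulrC [_ * p^-1]mulrC.
have -> : 1 - p^-1 = (p / (p - 1))^-1 by apply/eqP; rewrite subr_eq addrC pq.
by rewrite [_^-1 * `|x| `^ p]mulrC.
Qed.

(* Subgradient inequalities at [z = x + t (y - x)] towards both end points. *)
Lemma bregman_segment_le x y t : 0 <= t -> t <= 1 ->
  D (x + t *: (y - x)) x <= t * D y x.
Proof.
move=> t0 t1; set z := x + t *: (y - x).
have := bregman_ge0 z x; have := bregman_ge0 z y; rewrite /bregman.
have -> : y - z = (1 - t) *: (y - x) by rewrite /z opprD addrA scalerBl scale1r.
have -> : x - z = - t *: (y - x) by rewrite /z opprD addrA subrr sub0r scaleNr.
have -> : z - x = t *: (y - x) by rewrite /z addrC addKr.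
have pairingZ f a u : pairing f (a *: u) = a * pairing f u.
  by rewrite /pairing linearZ.
rewrite !pairingZ.
move: (pairing (j z) _) (pairing (j x) _) (F x) (F y) (F z) => a b fx fy fz hy hx.
have t1' : 0 <= 1 - t by rewrite subr_ge0.
(* With weights [t] and [1 - t] the two terms in [a], the pairing with [j z], cancel. *)
have := mulr_ge0 t0 hy; have := mulr_ge0 t1' hx.
by move=> ? ?; nra.
Qed.

(** The threshold makes the bound [|x|^(p-1) |y|] on the pairing at most half of [|y|^p / p]; the
    other half survives. *)
Lemma bregman_ge_far x y :
  ((2 * p) `^ (p - 1)^-1) * `|x| <= `|y| ->
  (2 * p)^-1 * `|y| `^ p <= D y x.
Proof.
move=> xy; have p1 : p - 1 != 0 by rewrite subr_eq0 gt_eqF.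
have pn0 : p != 0 by rewrite gt_eqF.
have p2 : 0 < 2 * p by rewrite mulr_gt0.
have h : `|x| `^ (p - 1) <= (2 * p)^-1 * `|y| `^ (p - 1).
  rewrite ler_pdivlMl//.
  have -> : 2 * p * `|x| `^ (p - 1) =
      ((2 * p) `^ (p - 1)^-1 * `|x|) `^ (p - 1).
    by rewrite powRM ?powR_ge0// -powRrM mulVf// powRr1// ltW.
  by apply: ge0_ler_powR; rewrite ?nnegrE ?subr_ge0 ?mulr_ge0 ?powR_ge0// ltW.
have h' : `|x| `^ (p - 1) * `|y| <= (2 * p)^-1 * `|y| `^ p.
  by rewrite -(mulr_powRB1 (normr_ge0 y) p_gt0) [`|y| * _]mulrC mulrA ler_wpM2r.
have e : p^-1 = (2 * p)^-1 + (2 * p)^-1 by field.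
have x0 : 0 <= (1 - p^-1) * `|x| `^ p.
  by rewrite mulr_ge0 ?powR_ge0// subr_ge0 invf_le1// ltW.
rewrite bregman_norm_powE {1}e [X in _ <= X + _ - _]mulrDl.
by have := pairing_selection_le x y; lra.
Qed.

(** At the segment point at distance [c |x|] from [x], the argument of [phi] is exactly [c]. The
    convexity factor [t <= 1] can be discarded because the divergence is nonnegative. *)
Lemma bregman_ge_outside_ball C c (phi : R -> R) x y : 0 < c -> x != 0 ->
  (forall z, `|x - z| <= c * `|x| ->
     C * `|x| `^ p * phi (`|x - z| / `|x|) <= D z x) ->
  c * `|x| < `|x - y| -> C * `|x| `^ p * phi c <= D y x.
Proof.
move=> c0 x0 hC far.
have nx : 0 < `|x| by rewrite normr_gt0.
have r0 : 0 < `|x - y| by apply: lt_trans far; rewrite mulr_gt0.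
pose t := c * `|x| / `|x - y|.
have t0 : 0 <= t by rewrite divr_ge0// mulr_ge0// ltW.
have t1 : t <= 1 by rewrite ler_pdivrMr// mul1r ltW.
have xz : `|x - (x + t *: (y - x))| = c * `|x|.
  rewrite opprD addrA subrr sub0r normrN normrZ (ger0_norm t0) (distrC y).
  by rewrite /t divfK// gt_eqF.
have := hC (x + t *: (y - x)); rewrite xz mulfK ?gt_eqF// lexx => /(_ isT) le1.
apply: le_trans le1 _; apply: le_trans (bregman_segment_le x y t0 t1) _.
by rewrite ler_piMl// bregman_ge0.
Qed.

Lemma bregman_local_global (phi : R -> R)
  (phi_ge0 : forall t : R, 0 <= t -> 0 <= phi t)
  (phi_nondecreasing : forall s t : R, 0 <= s -> s <= t -> phi s <= phi t)
  (phi_gt0 : forall t : R, 0 < t -> 0 < phi t) :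
  bregman_lower_local p j phi -> bregman_lower_global p j phi.
Proof.
move=> [C [c [C0 c0 hC]]].
have phi2 : 0 < phi 2 by exact: phi_gt0.
pose K := (2 * p) `^ (p - 1)^-1.
(* [L >= K] gives access to the far estimate, and [L >= 1] yields [M = |y|] in the far case and
   [M <= L |x|] otherwise. *)
pose L := 1 + K.
have K0 : 0 <= K by exact: powR_ge0.
have L0 : 0 < L by rewrite ltr_pwDl.
(* For [r <= 2], [th * phi r] is below both [phi r] and [phi c], which serves inside and outside the
   local ball at once. *)
pose th := Num.min 1 (phi c / phi 2).
have th0 : 0 < th by rewrite lt_min ltr01 divr_gt0// phi_gt0.
(* The first entry serves [|y| <= L |x|], where [L^p] pays for replacing [M^p] by [|x|^p]; the
   second serves the far case. *)
exists (Num.min (C * (L `^ p)^-1 * th) ((2 * p)^-1 * (phi 2)^-1)); split.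
  rewrite lt_min !mulr_gt0 ?invr_gt0 ?powR_gt0 ?mulr_gt0//.
move=> x y; rewrite /V_domain /= => x0.
have nx : 0 < `|x| by rewrite normr_gt0.
set M := Num.max `|x| `|y|.
have xM : `|x| <= M by rewrite le_max lexx.
have yM : `|y| <= M by rewrite le_max lexx orbT.
have M0 : 0 < M by exact: lt_le_trans xM.
have rM0 : 0 <= `|x - y| / M by rewrite divr_ge0// ltW.
have phir0 : 0 <= phi (`|x - y| / M) by exact: phi_ge0.
have phir2 : phi (`|x - y| / M) <= phi 2.
  apply: phi_nondecreasing => //; rewrite ler_pdivrMr//.
  by apply: le_trans (ler_normB _ _) _; lra.
have Mp0 : 0 <= M `^ p by exact: powR_ge0.
have [yL|Ly] := leP `|y| (L * `|x|); last first.
  have My : M = `|y|.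
    apply/max_r/(le_trans _ (ltW Ly)); rewrite ler_peMl//.
    by rewrite lerDl.
  apply: le_trans (bregman_ge_far _); last first.
    by apply: le_trans (ltW Ly); rewrite ler_wpM2r// lerDr.
  rewrite -My; set A := Num.min _ _.
  have hA : A <= (2 * p)^-1 * (phi 2)^-1 by rewrite ge_min lexx orbT.
  apply: le_trans (ler_wpM2r phir0 (ler_wpM2r Mp0 hA)) _.
  rewrite mulrAC -mulrA [_ / phi 2 * _]mulrAC -[leLHS]mulrA ler_wpM2l//.
    by rewrite invr_ge0 mulr_ge0// ltW.
  by rewrite ler_pdivrMr// mulrC ler_wpM2l.
have Mx : M `^ p <= L `^ p * `|x| `^ p.
  rewrite -powRM// ?(ltW L0)//; apply: ge0_ler_powR; rewrite ?nnegrE.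
  - exact: ltW.
  - exact: ltW.
  - by rewrite mulr_ge0// ltW.
  - by rewrite ge_max yL andbT ler_peMl// lerDl.
apply: (@le_trans _ _ (C * `|x| `^ p * (th * phi (`|x - y| / M)))).
  rewrite mulrA ler_wpM2r//.
  set A := Num.min _ _.
  have hA : A <= C * (L `^ p)^-1 * th by rewrite ge_min lexx.
  apply: le_trans (ler_wpM2r Mp0 hA) _.
  rewrite mulrAC ler_pM2r// -mulrA ler_pM2l// ler_pdivrMl//.
  exact: powR_gt0.
have Cx0 : 0 < C * `|x| `^ p by rewrite mulr_gt0// powR_gt0.
have [near|far] := leP `|x - y| (c * `|x|).
  apply: le_trans (hC x y x0 near); rewrite ler_pM2l//.
  apply: (@le_trans _ _ (phi (`|x - y| / M))).
    by rewrite ler_piMl// ge_min lexx.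
  (* Dividing by [M >= |x|] only lowers the argument of [phi]. *)
  by apply: phi_nondecreasing => //; rewrite ler_wpM2l// lef_pV2.
apply: le_trans (bregman_ge_outside_ball c0 x0 (fun z => hC x z x0) far).
rewrite ler_pM2l//.
have hth : th <= phi c / phi 2 by rewrite ge_min lexx orbT.
apply: le_trans (ler_wpM2r phir0 hth) _.
rewrite mulrAC ler_pdivrMr// ler_wpM2l// ltW//; exact: phi_gt0.
Qed.

End Bregman.

Theorem proposition4p4 (R : realType) (X : completeNormedModType R)
  (hdim : dim_ge X 2)
  (p : R) (hp : 1 < p)
  (j : X -> dual X) (hj : duality_selection p j)
  (phi : R -> R)
  (phi_ge0 : forall t : R, 0 <= t -> 0 <= phi t)
  (phi_nondecreasing : forall s t : R, 0 <= s -> s <= t -> phi s <= phi t)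
  (phi_gt0 : forall t : R, 0 < t -> 0 < phi t) :
  (bregman_lower_local p j phi -> bregman_lower_global p j phi) /\
  (bregman_lower_global p j phi -> sym_bregman_lower_global p j phi).
Proof.
split; first exact: bregman_local_global.
move=> [C [C0 hC]]; exists C; split=> // x y Vxy.
apply: le_trans (hC x y Vxy) _.
by rewrite /sym_bregman lerDl bregman_ge0.
Qed.
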